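(* Fix positive integers $r,s$, put $n=r+s$, and let $\mathfrak{C}\in k^n$. Then (1) the $t$-module $(E',\rho)$ is defined over $A$, i.e. $\rho_t=\sum_i\alpha_i\tau^i$ with all $\alpha_i\in\mathrm{Mat}_d(A)$; and (2) $\mathbf{v}_\mathfrak{C}$ is an integral point, i.e. $\mathbf{v}_\mathfrak{C}\in E'(A)=\mathrm{Mat}_{d\times1}(A)$.
   Context: $q$ is a power of a prime $p$; $A=\mathbb{F}_q[\theta]$, $k=\mathbb{F}_q(\theta)$, $\bar k$ an algebraic closure of $k$ (inside $\mathbb{C}_\infty$, the completion of an algebraic closure of $\mathbb{F}_q((1/\theta))$). Let $D_0=1$, $D_i=\prod_{j=0}^{i-1}(\theta^{q^i}-\theta^{q^j})$; for $m=\sum m_iq^i$ ($0\le m_i\le q-1$) put $\Gamma_{m+1}=\prod_iD_i^{m_i}$. With $t$ a new variable, $G_0(y)=1$, $G_m(y)=\prod_{i=1}^m(t^{q^m}-y^{q^i})$, the Anderson–Thakur polynomials $H_m\in A[t]$ are defined by $\bigl(1-\sum_{i\ge0}\frac{G_i(\theta)}{D_i|_{\theta=t}}x^{q^i}\bigr)^{-1}=\sum_{m\ge0}\frac{H_m}{\Gamma_{m+1}|_{\theta=t}}x^m$. For $f=\sum c_it^i$, $f^{(-1)}=\sum c_i^{1/q}t^i$; $\bar k[t,\sigma]$ is the noncommutative $\bar k[t]$-algebra generated by $\sigma$ with $\sigma f=f^{(-1)}\sigma$. $M'$ is the left $\bar k[t,\sigma]$-module free over $\bar k[t]$ with basis $x_0,\dots,x_{n-1}$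 and $\sigma x_0=(t-\theta)^nx_0$, $\sigma x_i=H_{i-1}^{(-1)}(t-\theta)^nx_0+(t-\theta)^{n-i}x_i$ ($1\le i\le n-1$). It is free over $\bar k[\sigma]$ with basis $\nu_1,\dots,\nu_d$ ($d=n(n+1)/2$) equal to $(t-\theta)^{n-1}x_0,\dots,(t-\theta)x_0,x_0,(t-\theta)^{n-2}x_1,\dots,x_1,\dots,(t-\theta)x_{n-2},x_{n-2},x_{n-1}$. Define $\Delta:M'\to\mathrm{Mat}_{d\times1}(\bar k)$ by $\Delta(\sum_iu_i\nu_i)=(\delta(u_1),\dots,\delta(u_d))^T$, $\delta(\sum_j\sigma^jc_j)=\sum_jc_j$ ($c_j\in\bar k$). $\Delta$ induces an isomorphism $M'/(\sigma-1)M'\cong\mathrm{Mat}_{d\times1}(\bar k)$, and $(E',\rho)$ is the $t$-module with $E'(\bar k)=\mathrm{Mat}_{d\times1}(\bar k)$ and $\rho:\mathbb{F}_q[t]\to\mathrm{Mat}_d(\bar k[\tau])$ ($\tau c=c^q\tau$) determined by $\Delta(tm)=\rho_t(\Delta(m))$. For $\mathfrak{C}=(b_0,a_1,\dots,a_{n-1})\in k^n$, let $\Gamma_\mathfrak{C}\in A$ be the monic lcm of the denominators of $\{a_i/(\Gamma_i\Gamma_{n-i})\}_{i=1}^{n-1}\cup\{b_0/\Gamma_n,1/(\Gamma_r\Gamma_s)\}$, $\alpha_i=\frac{a_i\Gamma_\mathfrak{C}}{\Gamma_i\Gamma_{n-i}}|_{\theta=t}$, $\beta_0=\frac{b_0\Gamma_\mathfrak{C}}{\Gamma_n}|_{\theta=t}$,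 $\gamma_0=\frac{\Gamma_\mathfrak{C}}{\Gamma_r\Gamma_s}|_{\theta=t}$, $f_0=\beta_0H_{n-1}^{(-1)}(t-\theta)^n-\gamma_0H_{r-1}^{(-1)}H_{s-1}^{(-1)}(t-\theta)^n$, $f_j=\alpha_jH^{(-1)}_{(n-j)-1}(t-\theta)^{n-j}$ ($1\le j\le n-1$), and $\mathbf{v}_\mathfrak{C}:=\Delta(\sum_{i=0}^{n-1}f_ix_i)$ (the image of the class of the Frobenius module $M_\mathfrak{C}$ defined by the matrix with upper-left block the matrix of $\sigma$ on $M'$ and last row $(f_0,\dots,f_{n-1},1)$). *)

(* Defs.v *)
From HB Require Import structures.
From mathcomp Require Import all_boot all_order all_algebra all_field.
From mathcomp Require Import ring.

Set Implicit Arguments.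
Unset Strict Implicit.
Unset Printing Implicit Defensive.

Import GRing.Theory.
Local Open Scope ring_scope.

Notation "p %:F" := (@FracField.tofrac _ p) : ring_scope.

Section FrobeniusPowers.
Variables (F : finFieldType) (R : comNzRingType) (f : {rmorphism F -> R}).

Lemma pnat_cardF : [pchar R].-nat #|F|.
Proof.
have [p p_pr pF] := finPcharP F.
rewrite (card_pprimeChar pF) (eq_pnat _ (pcharf_eq (rmorph_pchar f pF))).
by rewrite pnatX pnat_id.
Qed.

Lemma frobD k (x y : R) :
  (x + y) ^+ (#|F| ^ k) = x ^+ (#|F| ^ k) + y ^+ (#|F| ^ k).
Proof. by apply: exprDn_pchar; rewrite pnatX pnat_cardF. Qed.

Lemma frob0 k : (0 : R) ^+ (#|F| ^ k) = 0.
Proof.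
by rewrite expr0n expn_eq0 -[#|F| == 0%N]negbK -lt0n (ltnW (finNzRing_gt1 F)).
Qed.

Lemma frobB k (x y : R) :
  (x - y) ^+ (#|F| ^ k) = x ^+ (#|F| ^ k) - y ^+ (#|F| ^ k).
Proof.
by apply: (addIr (y ^+ (#|F| ^ k))); rewrite -frobD !subrK.
Qed.

Lemma frob_sum k I (r : seq I) (P : pred I) (g : I -> R) :
  (\sum_(i <- r | P i) g i) ^+ (#|F| ^ k)
  = \sum_(i <- r | P i) g i ^+ (#|F| ^ k).
Proof.
exact: (big_morph (fun x => x ^+ (#|F| ^ k)) (frobD k) (frob0 k)).
Qed.

End FrobeniusPowers.

(* A = F_q[theta] is {poly F} and k = F_q(theta) its fraction field.  An      *)
(* element of A[t] is a {poly {poly F}}: 'X is t and 'X%:P is theta.  The     *)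
(* specialization of a in A at theta = t is a^:P.                             *)
Section Carlitz.
Variable F : finFieldType.
Local Notation A := {poly F}.
Local Notation At := {poly {poly F}}.
Local Notation q := #|F|.

Definition carlitzD (i : nat) : A :=
  \prod_(j < i) ('X ^+ (q ^ i) - 'X ^+ (q ^ j)).

(* carlitzGamma m.+1 is the product of the D_i ^+ m_i, m_i the digits of m    *)
(* in base q; the digits at i > m vanish.  carlitzGamma 0 is not used.        *)
Definition carlitzGamma (m : nat) : A :=
  \prod_(i < m) carlitzD i ^+ ((m.-1 %/ q ^ i) %% q).

Definition AT_G (m : nat) (y : At) : At :=
  \prod_(1 <= i < m.+1) ('X ^+ (q ^ m) - y ^+ (q ^ i)).

(* Coefficient of x^N in 1 - \sum_i G_i(theta) / D_i(t) x^(q^i); q^i = N      *)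
(* forces i <= N.                                                             *)
Definition AT_denominator (N : nat) : {fraction At} :=
  (N == 0%N)%:R
  - \sum_(i < N.+1 | (q ^ i)%N == N) (AT_G i 'X%:P)%:F / ((carlitzD i)^:P)%:F.

Let q_gt1 : (1 < q)%N. Proof. exact: finNzRing_gt1. Qed.
Let q_gt0 : (0 < q)%N. Proof. exact: ltnW q_gt1. Qed.

Lemma carlitzD_neq0 i : carlitzD i != 0.
Proof.
apply/prodf_neq0 => j _; rewrite subr_eq0; apply/eqP => /(congr1 (size : A -> nat)).
rewrite !size_polyXn => /eq_add_S/(expnI q_gt1) Eij.
by have := ltn_ord j; rewrite -Eij ltnn.
Qed.

Lemma carlitzGamma_neq0 m : carlitzGamma m != 0.
Proof.
by apply/prodf_neq0 => i _; apply: expf_neq0; apply: carlitzD_neq0.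
Qed.

Lemma carlitzD_dvdS i : carlitzD i ^+ q %| carlitzD i.+1.
Proof.
rewrite [carlitzD i.+1]/carlitzD big_ord_recl /= dvdp_mull //.
rewrite (_ : carlitzD i ^+ q = \prod_(j < i) ('X ^+ (q ^ i.+1) - 'X ^+ (q ^ lift ord0 j))) //.
rewrite -prodrXl; apply: eq_bigr => j _.
rewrite -[X in _ ^+ X = _]expn1 (frobB polyC) expn1.
by rewrite -!exprM -!expnSr.
Qed.

Let dig (m i : nat) := ((m %/ q ^ i) %% q)%N.
Let P B (m : nat) : A := \prod_(i < B) carlitzD i ^+ dig m i.

Let P_widen B m : (m < B)%N -> P B m = carlitzGamma m.+1.
Proof.
move=> ltmB; rewrite /P /carlitzGamma -/(dig m).
rewrite -(big_mkord xpredT (fun i => carlitzD i ^+ dig m i)) /=.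
rewrite (big_cat_nat (n := m.+1)) //= big_mkord.
rewrite [X in _ * X]big_nat_cond [X in _ * X]big1 ?mulr1 // => i /andP[/andP[ltmi _] _].
rewrite /dig divn_small ?mod0n ?expr0 //.
by apply: ltn_trans ltmi _; apply: ltn_expl.
Qed.

Let dig_split h e l i j : (e < q)%N -> (l < q ^ i)%N ->
  dig (h * q ^ i.+1 + e * q ^ i + l) j =
  if (j < i)%N then dig l j else if j == i then e else dig h (j - i.+1).
Proof.
move=> lteq ltl; rewrite /dig; case: ltngtP => [ltji|ltij|->].
- have ->: (h * q ^ i.+1 + e * q ^ i = ((h * q + e) * q ^ (i - j.+1) * q) * q ^ j)%N.
    by rewrite -!mulnA -expnS -expnD subnK // mulnDl -mulnA -expnS.
  rewrite divnMDl ?expn_gt0 ?q_gt0 // modnMDl //.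
- rewrite -(subnK ltij) addnK expnD [(q ^ _ * q ^ i.+1)%N]mulnC divnMA -addnA divnMDl ?expn_gt0 ?q_gt0 //.
  rewrite [((_ + l) %/ _)%N]divn_small ?addn0 //.
  rewrite expnS; apply: (@leq_trans (e.+1 * q ^ i)%N); last by rewrite leq_mul2r lteq orbT.
  by rewrite mulSn addnC ltn_add2r.
- rewrite expnS mulnA -mulnDl divnMDl ?expn_gt0 ?q_gt0 // divn_small // addn0.
  by rewrite modnMDl modn_small.
Qed.

Lemma carlitzGamma_dvd i m :
  carlitzD i * carlitzGamma m.+1 %| carlitzGamma (m + q ^ i).+1.
Proof.
elim/ltn_ind: m i => m IHm i.
have qi_gt0 : (0 < q ^ i)%N by rewrite expn_gt0 q_gt0.
pose l := (m %% q ^ i)%N; pose h := (m %/ q ^ i.+1)%N.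
pose e := (m %/ q ^ i %% q)%N.
have Em : m = (h * q ^ i.+1 + e * q ^ i + l)%N.
  rewrite {1}(divn_eq m (q ^ i)) {1}(divn_eq (m %/ q ^ i) q).
  by rewrite mulnDl -divnMA -expnSr -mulnA -expnS.
have ltl : (l < q ^ i)%N by rewrite ltn_mod.
have lteq : (e < q)%N by rewrite ltn_mod.
have Psplit e' B : (e' < q)%N -> (i < B)%N ->
  P B (h * q ^ i.+1 + e' * q ^ i + l) =
  carlitzD i ^+ e' * P B (h * q ^ i.+1 + 0 * q ^ i + l).
  move=> lte' ltiB; rewrite /P (bigD1 (Ordinal ltiB)) //=.
  rewrite [X in _ = _ * X](bigD1 (Ordinal ltiB)) //=.
  rewrite !dig_split ?q_gt0 //= ltnn eqxx expr0 mul1r; congr (_ * _).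
  apply: eq_bigr => j neji; rewrite !dig_split ?q_gt0 //.
  by rewrite (negPf (neji : (j != i :> nat))).
pose m0 := (h * q ^ i.+1 + 0 * q ^ i + l)%N.
pose B := (m + q ^ i).+1.
have ltiB : (i < B)%N.
  by apply: (leq_trans (ltn_expl i q_gt1)); rewrite /B -addSn leq_addl.
have ltmB : (m < B)%N by rewrite ltnS leq_addr.
rewrite -(P_widen ltmB) -(P_widen (leqnn B)).
have EmP : P B m = carlitzD i ^+ e * P B m0 by rewrite {1}Em Psplit.
have [lteq1|leqe1] := ltnP e.+1 q.
  rewrite (_ : m + q ^ i = h * q ^ i.+1 + e.+1 * q ^ i + l)%N; last first.
    by rewrite {1}Em mulSn; ring.
  by rewrite Psplit // EmP mulrA -exprS dvdpp.
have Eq : q = e.+1 by apply/eqP; rewrite eqn_leq leqe1 lteq.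
have ltm0m : (m0 < m)%N.
  rewrite [X in (_ < X)%N]Em /m0 mul0n addn0 ltn_add2r -[X in (X < _)%N]addn0 ltn_add2l.
  rewrite muln_gt0 qi_gt0 andbT lt0n; apply/eqP => e0.
  by move: q_gt1; rewrite Eq e0.
rewrite EmP mulrA -exprS -Eq.
have ltm0B : (m0 < B)%N by apply: ltn_trans ltm0m _.
rewrite (P_widen ltm0B); apply: dvdp_trans (_ : carlitzD i.+1 * carlitzGamma m0.+1 %| _).
  by rewrite dvdp_mul2r ?carlitzGamma_neq0 // carlitzD_dvdS.
rewrite (P_widen (leqnn B)).
rewrite (_ : m + q ^ i = m0 + q ^ i.+1)%N; first exact: IHm.
have Eqi : (q ^ i.+1 = q ^ i + e * q ^ i)%N by rewrite expnS [X in (X * _)%N]Eq mulSn.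
rewrite {1}Em /m0 mul0n addn0 [X in _ = (_ + X)%N]Eqi; ring.
Qed.

Let AT_c (N : nat) : seq {fraction At} :=
  iteri N (fun M s =>
    rcons s ((M == 0%N)%:R - \sum_(j < M) AT_denominator (M - j) * s`_j)) [::].

Lemma AT_denominator0 : AT_denominator 0 = 1.
Proof.
rewrite /AT_denominator big1 ?subr0 // => i; rewrite expn_eq0.
by rewrite -[#|F| == 0%N]negbK -lt0n q_gt0.
Qed.

(* The defining identity of the Anderson-Thakur polynomials, as an identity   *)
(* of coefficients of x^N in F_q(theta, t)[[x]].                              *)
Lemma AT_exists : {H : nat -> At | forall N,
  \sum_(j < N.+1)
    AT_denominator (N - j) * ((H j)%:F / ((carlitzGamma j.+1)^:P)%:F)
  = (N == 0%N)%:R}.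
Proof.
have c_size N : size (AT_c N) = N.
  by elim: N => //= N IHN; rewrite size_rcons IHN.
pose c N := (AT_c N.+1)`_N.
have c_nth N j : (j < N)%N -> (AT_c N)`_j = c j.
  elim: N => // N IHN; rewrite ltnS leq_eqVlt => /predU1P[->//|ltjN].
  by rewrite -IHN //= nth_rcons c_size ltjN.
have cE N : c N = (N == 0%N)%:R - \sum_(j < N) AT_denominator (N - j) * c j.
  rewrite {1}/c /= nth_rcons c_size ltnn eqxx; congr (_ - _).
  by apply: eq_bigr => j _; rewrite c_nth.
have H_int N : exists h : At, h%:F == ((carlitzGamma N.+1)^:P)%:F * c N.
  elim/ltn_ind: N => -[_|N IHN].
    exists ((carlitzGamma 1)^:P); by rewrite cE big_ord0 subr0 mulr1.
  suffices /(_ N.+1 (leqnn _))[h Eh] : forall M, (M <= N.+1)%N -> exists h : At,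
    h%:F = ((carlitzGamma N.+2)^:P)%:F *
             \sum_(j < M) AT_denominator (N.+1 - j) * c j.
    by exists (- h); rewrite tofracN Eh cE sub0r mulrN.
  elim=> [_|M IHM ltMN]; first by exists 0; rewrite big_ord0 mulr0 tofrac0.
  have [h1 Eh1] := IHM (ltnW ltMN); have [h2 /eqP Eh2] := IHN M ltMN.
  suffices [g Eg] : exists g : At, g%:F = ((carlitzGamma N.+2)^:P)%:F *
     ((\sum_(i < (N.+1 - M).+1 | (q ^ i)%N == (N.+1 - M)%N)
        (AT_G i 'X%:P)%:F / ((carlitzD i)^:P)%:F) * c M).
    exists (h1 - g); rewrite tofracB Eh1 Eg big_ord_recr /= mulrDr.
    rewrite [AT_denominator (N.+1 - M)]/AT_denominator.
    by rewrite subn_eq0 leqNgt ltMN sub0r mulNr mulrN.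
  have F_sum I (r : seq I) (Q : pred I) (G : I -> {fraction At}) :
      (forall i, Q i -> exists g : At, g%:F = G i) ->
      exists g : At, g%:F = \sum_(i <- r | Q i) G i.
    move=> QG; elim/big_ind: _ => [|x y [g <-] [g' <-]|//].
      by exists 0; rewrite tofrac0.
    by exists (g + g'); rewrite tofracD.
  rewrite mulr_suml mulr_sumr; apply: F_sum => i /eqP Ei.
  have := carlitzGamma_dvd i M.
  rewrite Ei subnKC; last exact: ltnW.
  move=> /(dvdpP _ _) /= [d Ed].
  exists (d^:P * AT_G i 'X%:P * h2).
  have nz (a : A) : a != 0 -> (a^:P)%:F != 0 :> {fraction At}.
    by rewrite tofrac_eq0 map_polyC_eq0.
  rewrite !tofracM Eh2 Ed !rmorphM /=.
  have aux (L : fieldType) (x u v w z : L) : x != 0 ->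
      u * v * (w * z) = u * (x * w) * (v / x * z).
    by move=> nzx; field.
  apply: aux; exact: nz (carlitzD_neq0 i).
exists (fun N => xchoose (H_int N)) => N.
have HE j : (xchoose (H_int j))%:F / ((carlitzGamma j.+1)^:P)%:F = c j.
  rewrite (eqP (xchooseP (H_int j))) mulrAC divff ?mul1r //.
  by rewrite tofrac_eq0 map_polyC_eq0 carlitzGamma_neq0.
under eq_bigr do rewrite HE.
by rewrite big_ord_recr /= subnn AT_denominator0 mul1r [c N]cE addrC subrK.
Qed.

(* H_m; the identity above determines it, each H_N occurring in the identity  *)
(* of index N with the nonzero factor 1 / Gamma_(N+1)(t).                     *)
Definition AT : nat -> At := sval AT_exists.

End Carlitz.

Section Denominators.
Variable F : finFieldType.
Local Notation A := {poly F}.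
Local Notation k := {fraction {poly F}}.

Definition to_monic (p : A) : A := (lead_coef p)^-1 *: p.

Definition lcmp (p p' : A) : A := to_monic ((p * p') %/ gcdp p p').

(* The monic denominator of x in lowest terms. *)
Definition denominator (x : k) : A :=
  to_monic (\d_(repr x) %/ gcdp \n_(repr x) \d_(repr x)).

(* The quotient of the Euclidean division of a numerator of x by the          *)
(* corresponding denominator; it is x itself when x is in A.                  *)
Definition polypart (x : k) : A := \n_(repr x) %/ \d_(repr x).

Lemma frac_repr (x : k) : x * (\d_(repr x))%:F = (\n_(repr x))%:F.
Proof.
rewrite -{1}[x]reprK; set y := repr x.
have -> : \pi_(FracField.type A)%qT y = (\n_y)%:F / (\d_y)%:F.
  rewrite -{1}[y]Ratio_numden.
  have nz : (\d_y)%:F != 0 :> k by rewrite tofrac_eq0 denom_ratioP.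
  apply: (mulIf nz); rewrite divfK //; unlock FracField.tofrac.
  rewrite -[LHS]FracField.pi_mul; apply/eqmodP => /=.
  rewrite /FracField.equivf /FracField.mulf.
  by rewrite !numden_Ratio ?mulr1 ?oner_neq0 ?denom_ratioP //= mulrC.
by rewrite divfK // tofrac_eq0 denom_ratioP.
Qed.

Lemma polypartK (a : A) : polypart a%:F = a.
Proof.
rewrite /polypart; have := frac_repr a%:F; rewrite -tofracM => /eqP.
by rewrite tofrac_eq => /eqP <-; rewrite mulpK // denom_ratioP.
Qed.

Lemma to_monic_eqp p : p != 0 -> to_monic p %= p.
Proof. by move=> nz; rewrite eqp_scale // invr_eq0 lead_coef_eq0. Qed.

Lemma to_monic_monic p : p != 0 -> to_monic p \is monic.
Proof. by move=> nz; rewrite monicE lead_coefZ mulVf // lead_coef_eq0. Qed.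

Lemma lcmp_monic p p' : p != 0 -> p' != 0 -> lcmp p p' \is monic.
Proof.
move=> nz nz'; apply: to_monic_monic; rewrite dvdp_div_eq0 ?mulf_neq0 //.
by rewrite dvdp_mulr // dvdp_gcdl.
Qed.

Lemma dvd_lcmp p p' g : p != 0 -> p' != 0 ->
  (lcmp p p' %| g) = (p %| g) && (p' %| g).
Proof.
move=> nz nz'; set d := gcdp p p'.
have nzd : d != 0 by rewrite gcdp_eq0 (negPf nz).
have [[u Eu] [u' Eu']] : (exists u, p = u * d) /\ (exists u', p' = u' * d).
  by split; apply/dvdpP; rewrite ?dvdp_gcdl ?dvdp_gcdr.
have El : (p * p') %/ d = u * p' by rewrite {1}Eu mulrAC mulpK.
have nzu : u != 0 by apply: contraNneq nz => u0; rewrite Eu u0 mul0r.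
have cuu' : coprimep u u'.
  have : gcdp (u * d) (u' * d) %= 1 * d by rewrite -Eu -Eu' mul1r eqpxx.
  by rewrite -(eqp_ltrans (mulp_gcdl _ _ _)) eqp_mul2r // coprimep_def => /eqp_size ->; rewrite size_poly1.
rewrite (eqp_dvdl _ (to_monic_eqp _)) ?El ?mulf_neq0 //.
apply/idP/andP => [dv|[/dvdpP[w Ew] dv']].
  split; apply: dvdp_trans dv; last exact: dvdp_mulIr.
  by rewrite Eu Eu' mulrCA dvdp_mulIr.
move: dv'; rewrite Ew Eu Eu' !mulrA !dvdp_mul2r // => dv'.
by rewrite [u * u']mulrC dvdp_mul2r //; move: dv'; rewrite Gauss_dvdpl // coprimep_sym.
Qed.

Lemma denominator_neq0 x : denominator x != 0.
Proof.
have nzd : \d_(repr x) != 0 := denom_ratioP _.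
have nz : \d_(repr x) %/ gcdp \n_(repr x) \d_(repr x) != 0.
  by rewrite dvdp_div_eq0 ?dvdp_gcdr.
by rewrite -lead_coef_eq0 (monicP (to_monic_monic nz)) oner_neq0.
Qed.

Lemma denominatorP x g :
  denominator x %| g <-> exists a : A, x * g%:F = a%:F.
Proof.
have nzd : \d_(repr x) != 0 := denom_ratioP _.
have nzdF : (\d_(repr x))%:F != 0 :> k by rewrite tofrac_eq0.
have Ex := frac_repr x; rewrite /denominator.
set y := repr x in nzd nzdF Ex *; set e := gcdp \n_y \d_y.
have nze : e != 0 by rewrite gcdp_eq0 (negPf nzd) andbF.
have [[v Ev] [w Ew]] : (exists v, \n_y = v * e) /\ (exists w, \d_y = w * e).
  by split; apply/dvdpP; rewrite ?dvdp_gcdl ?dvdp_gcdr.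
have nzw : w != 0 by apply: contraNneq nzd => w0; rewrite Ew w0 mul0r.
have cwv : coprimep w v.
  have : gcdp (v * e) (w * e) %= 1 * e by rewrite -Ev -Ew mul1r eqpxx.
  rewrite -(eqp_ltrans (mulp_gcdl _ _ _)) eqp_mul2r // coprimep_sym coprimep_def.
  by move=> /eqp_size ->; rewrite size_poly1.
have {}Ex : x * w%:F = v%:F.
  apply: (mulIf (_ : e%:F != 0)); first by rewrite tofrac_eq0.
  by rewrite -mulrA -!tofracM -Ew -Ev.
rewrite (eqp_dvdl _ (to_monic_eqp _)); last by rewrite Ew mulpK.
rewrite Ew mulpK //; split=> [/dvdpP[c ->]|[a Ea]].
  by exists (v * c); rewrite mulrC tofracM -mulrA [w%:F * _]mulrC Ex tofracM mulrC.
rewrite -(Gauss_dvdpr _ cwv); apply/dvdpP; exists a; apply/eqP.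
by rewrite -tofrac_eq !tofracM -Ea -Ex mulrAC.
Qed.

End Denominators.

(* C = (b_0, a_1, ..., a_(n-1)) with n = r + s: C`_0 is b_0 and, for i > 0,   *)
(* C`_i is a_i.                                                               *)
Section Coefficients.
Variables (F : finFieldType) (r s : nat) (C : (r + s).-tuple {fraction {poly F}}).
Local Notation n := (r + s)%N.
Local Notation k := {fraction {poly F}}.

Definition a_term (i : nat) : k :=
  C`_i / (carlitzGamma F i * carlitzGamma F (n - i))%:F.
Definition b_term : k := C`_0 / (carlitzGamma F n)%:F.
Definition c_term : k := 1 / (carlitzGamma F r * carlitzGamma F s)%:F.

Definition C_terms : seq k :=
  [seq a_term i | i <- iota 1 n.-1] ++ [:: b_term; c_term].

Definition GammaC : {poly F} := \big[@lcmp F/1]_(x <- C_terms) denominator x.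

Definition alpha (i : nat) : {poly {poly F}} :=
  (polypart (a_term i * GammaC%:F))^:P.
Definition beta0 : {poly {poly F}} := (polypart (b_term * GammaC%:F))^:P.
Definition gamma0 : {poly {poly F}} := (polypart (c_term * GammaC%:F))^:P.

Lemma GammaC_monic : GammaC \is monic.
Proof.
rewrite /GammaC; elim/big_rec: _ => [|x g _ g_mon]; first exact: monic1.
by rewrite lcmp_monic ?denominator_neq0 ?monic_neq0.
Qed.

Lemma GammaC_dvd g : (GammaC %| g) = all (fun x => denominator x %| g) C_terms.
Proof.
rewrite /GammaC; elim: C_terms => [|x t IHt] /=; first by rewrite big_nil dvd1p.
rewrite big_cons dvd_lcmp ?IHt ?denominator_neq0 //.
elim/big_rec: _ => [|y h _ nzh]; first exact: oner_neq0.
by rewrite monic_neq0 // lcmp_monic ?denominator_neq0.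
Qed.

Lemma GammaC_clears x : x \in C_terms ->
  (polypart (x * GammaC%:F))%:F = x * GammaC%:F.
Proof.
move=> Cx; have := dvdpp GammaC; rewrite GammaC_dvd => /allP/(_ _ Cx).
by move=> /denominatorP[a ->]; rewrite polypartK.
Qed.

End Coefficients.

(* An algebraic closure of k is a closedFieldType K with a morphism emb from  *)
(* k to K over which K is algebraic.                                          *)
Section AlgebraicClosure.
Variables (F : finFieldType) (K : closedFieldType).
Variable emb : {rmorphism {fraction {poly F}} -> K}.
Local Notation q := #|F|.

Definition embA (a : {poly F}) : K := emb a%:F.
Definition embAt : {poly {poly F}} -> {poly K} := map_poly embA.

Definition integral_mx m n (v : 'M[K]_(m, n)) : Prop :=
  exists w : 'M[{poly F}]_(m, n), v = map_mx embA w.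

Lemma qroot_subproof (x : K) : exists y, y ^+ q == x.
Proof.
have q_gt0 : (0 < q)%N := ltnW (finNzRing_gt1 F).
have /closed_rootP[y] : size ('X^q - x%:P) != 1%N.
  by rewrite size_XnsubC //; case: (q) q_gt0.
by rewrite rootE !hornerE subr_eq0 => Ey; exists y.
Qed.

Definition qroot (x : K) : K := xchoose (qroot_subproof x).

(* f^(-1) *)
Definition twist (f : {poly K}) : {poly K} := map_poly qroot f.

Definition t_theta : {poly K} := 'X - (embA 'X)%:P.

Let FtoK : {rmorphism F -> K} := emb \o (@FracField.tofrac _) \o polyC.

Lemma frobDK i (x y : K) : (x + y) ^+ (q ^ i) = x ^+ (q ^ i) + y ^+ (q ^ i).
Proof. exact: (frobD FtoK). Qed.

Lemma qrootK x : qroot x ^+ q = x.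
Proof. exact/eqP/(xchooseP (qroot_subproof x)). Qed.

Lemma expq_inj : injective (fun x : K => x ^+ q).
Proof.
move=> x y /eqP; rewrite -subr_eq0 -[q]expn1 -(frobB FtoK) expn1 expf_eq0.
by rewrite subr_eq0 => /andP[_ /eqP].
Qed.

Lemma expqK x : qroot (x ^+ q) = x.
Proof. by apply: expq_inj; rewrite /= qrootK. Qed.

Lemma qrootD x y : qroot (x + y) = qroot x + qroot y.
Proof.
by apply: expq_inj; rewrite /= -[q in RHS]expn1 frobDK expn1 !qrootK.
Qed.

Lemma qrootM x y : qroot (x * y) = qroot x * qroot y.
Proof. by apply: expq_inj; rewrite /= exprMn !qrootK. Qed.

Lemma qroot1 : qroot 1 = 1.
Proof. by rewrite -{1}(expr1n K q) expqK. Qed.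

Lemma qroot0 : qroot 0 = 0.
Proof. by apply: (addIr (qroot 0)); rewrite -qrootD !add0r. Qed.

Lemma coef_twist f i : (twist f)`_i = qroot f`_i.
Proof. by rewrite coef_map_id0 // qroot0. Qed.

Lemma twistD f g : twist (f + g) = twist f + twist g.
Proof. by apply/polyP => i; rewrite !(coefD, coef_twist) qrootD. Qed.

Lemma twist0 : twist 0 = 0.
Proof. by apply/polyP => i; rewrite !(coef0, coef_twist) qroot0. Qed.

Lemma twistM f g : twist (f * g) = twist f * twist g.
Proof.
apply/polyP => i; rewrite !(coefM, coef_twist).
rewrite (big_morph qroot qrootD qroot0); apply: eq_bigr => j _.
by rewrite qrootM !coef_twist.
Qed.

Lemma twistC c : twist c%:P = (qroot c)%:P.
Proof.
by apply/polyP => i; rewrite !(coefC, coef_twist); case: eqP; rewrite ?qroot0.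
Qed.

Lemma twistX : twist 'X = 'X.
Proof.
apply/polyP => i; rewrite !(coefX, coef_twist).
by case: (i == 1)%N; rewrite ?qroot0 ?qroot1.
Qed.

Lemma twist_inj : injective twist.
Proof.
move=> f g /polyP Efg; apply/polyP => i; have := Efg i; rewrite !coef_twist.
by move=> /(congr1 (fun x => x ^+ q)); rewrite /= !qrootK.
Qed.

Lemma twist_onto f : {g | twist g = f & size g = size f}.
Proof.
have z : (0 : K) ^+ q = 0 by rewrite -[q]expn1 (frob0 F K 1).
exists (map_poly (fun x => x ^+ q) f).
  by apply/polyP => i; rewrite coef_twist coef_map_id0 // expqK.
have [->|nz] := eqVneq f 0; first by rewrite map_poly0.
by apply: size_map_poly_id0; rewrite expf_neq0 // lead_coef_eq0.
Qed.

Section Module.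
Variable n : nat.

(* M' is the free K[t]-module of row vectors, x_i being the i-th basis vector *)
(* (numbered from 0); row i of sigma_matrix is sigma x_i.                     *)
Definition sigma_matrix : 'M[{poly K}]_n :=
  \matrix_(i, j)
    ((t_theta ^+ (n - i)) *+ (i == j)
     + (twist (embAt (AT F i.-1)) * t_theta ^+ n)
         *+ ((0 < i)%N && (j == 0%N :> nat))).

Definition sigma (m : 'rV[{poly K}]_n) : 'rV[{poly K}]_n :=
  map_mx twist m *m sigma_matrix.

(* (t - theta)^(n-1) x_0, ..., x_0, (t - theta)^(n-2) x_1, ..., x_(n-1)       *)
Definition nus : seq 'rV[{poly K}]_n :=
  [seq t_theta ^+ l *: delta_mx 0 i | i <- enum 'I_n, l <- rev (iota 0 (n - i))].

Definition dimE : nat := (n * n.+1)./2.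

(* A polynomial u stands here for the element \sum_j sigma^j u`_j of          *)
(* K[sigma], with coefficients on the right.                                  *)
Definition sigma_comb (u : 'I_dimE -> {poly K}) : 'rV[{poly K}]_n :=
  \sum_(i < dimE) \sum_(j < size (u i)) iter j sigma (((u i)`_j)%:P *: nus`_i).

Definition delta (u : {poly K}) : K := \sum_(j < size u) u`_j.

(* alpha represents \sum_i alpha`_i tau^i.                                    *)
Definition tau_act (alpha : seq 'M[K]_dimE) (v : 'cV[K]_dimE) : 'cV[K]_dimE :=
  \sum_(i < size alpha) alpha`_i *m map_mx (fun c => c ^+ (q ^ i)) v.

Let nu_idx : seq ('I_n * nat) :=
  [seq (i, l) | i : 'I_n <- enum 'I_n, l : nat <- rev (iota 0 (n - i))].
Let base (il : 'I_n * nat) : 'rV[{poly K}]_n := t_theta ^+ il.2 *: delta_mx 0 il.1.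

Let nusE : nus = map base nu_idx.
Proof. by rewrite map_allpairs. Qed.

Let nu_idx_size : size nu_idx = dimE.
Proof.
rewrite size_allpairs_dep (eq_map (g := fun i : 'I_n => (n - i)%N)); last first.
  by move=> i /=; rewrite size_rev size_iota.
rewrite sumnE big_map big_enum /= (reindex_inj rev_ord_inj) /=.
transitivity (\sum_(0 <= i < n.+1) i)%N; last first.
  by rewrite bin2_sum bin2 mulnC.
rewrite big_nat_recl // add0n big_mkord; apply: eq_bigr => i _.
by rewrite subKn // ltn_ord.
Qed.

Let nu_idx_mem i l : ((i, l) \in nu_idx) = (l < n - i)%N.
Proof.
apply/allpairsPdep/idP => [[j [m [_]]]|ltl].
  by rewrite mem_rev mem_iota add0n => /andP[_ ltm] [-> ->].
by exists i, l; split; rewrite ?mem_enum // mem_rev mem_iota.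
Qed.

Let nu_idx_uniq : uniq nu_idx.
Proof.
apply: allpairs_uniq_dep; first exact: enum_uniq.
  by move=> i _; rewrite rev_uniq iota_uniq.
by move=> [i l] [j m] _ _ /= [-> ->].
Qed.

Let nus_nth (k : 'I_dimE) (il0 : 'I_n * nat) :
  nus`_k = base (nth il0 nu_idx k).
Proof. by rewrite nusE (nth_map il0) // nu_idx_size. Qed.

Lemma size_nus : size nus = dimE.
Proof. by rewrite nusE size_map nu_idx_size. Qed.

Lemma sigmaD m m' : sigma (m + m') = sigma m + sigma m'.
Proof.
by rewrite /sigma -mulmxDl; congr (_ *m _); apply/matrixP => i j; rewrite !mxE twistD.
Qed.

Lemma sigma0 : sigma 0 = 0.
Proof.
by rewrite /sigma (_ : map_mx _ _ = 0) ?mul0mx //; apply/matrixP => i j; rewrite !mxE twist0.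
Qed.

Lemma sigmaZ f m : sigma (f *: m) = twist f *: sigma m.
Proof.
by rewrite /sigma scalemxAl; congr (_ *m _); apply/matrixP => i j; rewrite !mxE twistM.
Qed.

Lemma sigma_sum I (r : seq I) (P : pred I) (G : I -> 'rV_n) :
  sigma (\sum_(i <- r | P i) G i) = \sum_(i <- r | P i) sigma (G i).
Proof. exact: (big_morph sigma sigmaD sigma0). Qed.

Lemma iter_sigmaD j m m' :
  iter j sigma (m + m') = iter j sigma m + iter j sigma m'.
Proof. by elim: j => //= j ->; rewrite sigmaD. Qed.

Lemma iter_sigma0 j : iter j sigma 0 = 0.
Proof. by elim: j => //= j ->; rewrite sigma0. Qed.

Lemma iter_sigmaC j c m :
  c%:P *: iter j sigma m = iter j sigma ((c ^+ (q ^ j))%:P *: m).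
Proof.
elim: j c => [|j IHj] c; first by rewrite expr1.
rewrite iterS -[c]expqK -twistC -sigmaZ IHj expqK -exprM.
by rewrite -iterS expnS.
Qed.

Lemma iter_sigmaX j m : 'X *: iter j sigma m = iter j sigma ('X *: m).
Proof. by elim: j => //= j <-; rewrite sigmaZ twistX. Qed.

Lemma sigma_coord m j : sigma m 0 j = \sum_i twist (m 0 i) * sigma_matrix i j.
Proof. by rewrite mxE; apply: eq_bigr => i _; rewrite mxE. Qed.

Let term (v : 'rV[{poly K}]_n) (p : {poly K}) : 'rV[{poly K}]_n :=
  \sum_(j < size p) iter j sigma ((p`_j)%:P *: v).

Let term_widen N v (p : {poly K}) : (size p <= N)%N ->
  term v p = \sum_(j < N) iter j sigma ((p`_j)%:P *: v).
Proof.
move=> lepN; rewrite /term.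
rewrite -(big_mkord xpredT (fun j => iter j sigma ((p`_j)%:P *: v))).
rewrite -(big_mkord xpredT (fun j => iter j sigma ((p`_j)%:P *: v))) /=.
rewrite [RHS](big_cat_nat (n := size p)) //= [X in _ + X]big_nat_cond.
rewrite [X in _ + X]big1 ?addr0 // => j /andP[/andP[lepj _] _].
by rewrite nth_default // scale0r iter_sigma0.
Qed.

Let termD v (p p' : {poly K}) : term v (p + p') = term v p + term v p'.
Proof.
pose N := maxn (size p) (size p').
rewrite !(@term_widen N) ?leq_maxl ?leq_maxr ?(leq_trans (size_polyD _ _)) //.
rewrite -big_split; apply: eq_bigr => j _ /=.
by rewrite -iter_sigmaD coefD polyCD scalerDl.
Qed.

Let term0 v : term v 0 = 0.
Proof. by rewrite /term size_poly0 big_ord0. Qed.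

Let termC v c : term v c%:P = c%:P *: v.
Proof. by rewrite (@term_widen 1) ?size_polyC_leq1 // big_ord1 coefC. Qed.

Let term_sigma v p : sigma (term v p) = term v (p * 'X).
Proof.
rewrite (@term_widen (size p).+1 v (p * 'X)); last first.
  by rewrite (leq_trans (size_polyMleq _ _)) // size_polyX addnC.
rewrite big_ord_recl coefMX /= scale0r add0r /term sigma_sum.
by apply: eq_bigr => j _; rewrite coefMX.
Qed.

Let term_scale v c (p : {poly K}) :
  c%:P *: term v p = term v (\poly_(j < size p) (c ^+ (q ^ j) * p`_j)).
Proof.
rewrite (@term_widen (size p) v (\poly_(_ < _) _)) ?size_poly // scaler_sumr.
apply: eq_bigr => j _; rewrite iter_sigmaC scalerA -polyCM coef_poly ltn_ord //.
Qed.

Let combE u : sigma_comb u = \sum_(i < dimE) term nus`_i (u i).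
Proof. by []. Qed.

Lemma sigma_combD u u' :
  sigma_comb (fun i => u i + u' i) = sigma_comb u + sigma_comb u'.
Proof. by rewrite !combE -big_split; apply: eq_bigr => i _; rewrite termD. Qed.

Lemma sigma_comb_sigma u : sigma (sigma_comb u) = sigma_comb (fun i => u i * 'X).
Proof. by rewrite !combE sigma_sum; apply: eq_bigr => i _; rewrite term_sigma. Qed.

Let spanned m := exists u : {ffun 'I_dimE -> {poly K}}, sigma_comb u == m.

Let sigma_comb_ext u u' : u =1 u' -> sigma_comb u = sigma_comb u'.
Proof. by move=> Eu; apply: eq_bigr => i _; rewrite Eu. Qed.

Let spannedI u : spanned (sigma_comb u).
Proof.
by exists (finfun u); apply/eqP/sigma_comb_ext => i; rewrite ffunE.
Qed.

Let spannedD m m' : spanned m -> spanned m' -> spanned (m + m').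
Proof. by move=> [u /eqP<-] [u' /eqP<-]; rewrite -sigma_combD; apply: spannedI. Qed.

Let spanned_sigma m : spanned m -> spanned (sigma m).
Proof. by move=> [u /eqP<-]; rewrite sigma_comb_sigma; apply: spannedI. Qed.

Let spannedC c m : spanned m -> spanned (c%:P *: m).
Proof.
move=> [u /eqP<-]; rewrite combE scaler_sumr.
rewrite (eq_bigr _ (fun i _ => term_scale _ _ _)) -combE; exact: spannedI.
Qed.

Let spanned0 : spanned 0.
Proof.
rewrite (_ : 0 = sigma_comb (fun=> 0)); first exact: spannedI.
by rewrite combE big1 // => i _; rewrite term0.
Qed.

Let spanned_sum I (r : seq I) (P : pred I) (G : I -> 'rV_n) :
  (forall i, P i -> spanned (G i)) -> spanned (\sum_(i <- r | P i) G i).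
Proof. by move=> PG; elim/big_ind: _. Qed.

Let comb1 (k : 'I_dimE) (c : K) :
  sigma_comb (fun i => if i == k then c%:P else 0) = c%:P *: nus`_k.
Proof.
rewrite combE (bigD1 k) //= eqxx termC big1 ?addr0 // => i /negPf->.
exact: term0.
Qed.

Let spanned_nu v : v \in nus -> spanned v.
Proof.
move=> nuv; have ltv : (index v nus < dimE)%N by rewrite -size_nus index_mem.
have := comb1 (Ordinal ltv) 1; rewrite scale1r /= nth_index // => <-.
exact: spannedI.
Qed.

Let sigma_base (i : 'I_n) : sigma (delta_mx 0 i) = row i sigma_matrix.
Proof.
rewrite /sigma rowE; congr (_ *m _); apply/matrixP => a b; rewrite !mxE.
by case: (_ && _); rewrite ?mulr1n ?mulr0n ?twist0 // -polyC1 twistC qroot1.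
Qed.

Let t_theta_monic : t_theta \is monic. Proof. exact: monicXsubC. Qed.

Let size_t_theta_exp l : size (t_theta ^+ l) = l.+1.
Proof. exact: size_exp_XsubC. Qed.

Let spanned_low (i : 'I_n) (p : {poly K}) : (size p <= n - i)%N -> spanned (p *: delta_mx 0 i).
Proof.
move=> lep; have -> : p = (p \Po ('X + (embA 'X)%:P)) \Po t_theta.
  by rewrite -comp_polyA comp_polyD comp_polyX comp_polyC subrK comp_polyXr.
rewrite (comp_polyE _ t_theta) scaler_suml; apply: spanned_sum => l _.
rewrite -mul_polyC -scalerA; apply/spannedC/spanned_nu.
rewrite nusE; apply/mapP; exists (i, nat_of_ord l) => //.
rewrite nu_idx_mem (leq_trans (ltn_ord l)) //.
by rewrite size_comp_poly2 // size_XaddC.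
Qed.

Let spanned_step (i : 'I_n) (h : 'rV_n) :
  t_theta ^+ (n - i) *: delta_mx 0 i = sigma (delta_mx 0 i + h) ->
  (forall p, spanned (p *: h)) ->
  forall p, spanned (p *: delta_mx 0 i).
Proof.
move=> Eh Sh p; elim: {p}(size p) {-2}p (leqnn (size p)) => [|N IHN] p lep.
  by apply: spanned_low; apply: leq_trans lep _.
set D := t_theta ^+ (n - i) in Eh; have nzD : D != 0 by rewrite monic_neq0 ?monic_exp.
rewrite (divp_eq p D) scalerDl; apply: spannedD; last first.
  by apply: spanned_low; rewrite -ltnS -(size_t_theta_exp (n - i)) ltn_modp.
have [p' Ep' szp'] := twist_onto (p %/ D).
rewrite -scalerA Eh -Ep' -sigmaZ scalerDr; apply/spanned_sigma/spannedD => //.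
apply: IHN; rewrite szp' size_divp // size_t_theta_exp /= leq_subLR.
by rewrite (leq_trans lep) // -add1n leq_add2r subn_gt0.
Qed.

Let sigma_delta0 (i : 'I_n) : i = 0%N :> nat ->
  sigma (delta_mx 0 i) = t_theta ^+ n *: delta_mx 0 i.
Proof.
move=> i0; rewrite sigma_base; apply/rowP => j; rewrite !mxE i0 ltnn addr0 subn0.
by rewrite eqxx eq_sym mulr_natr.
Qed.

Let sigma_deltaS (i i0 : 'I_n) : (0 < i)%N -> i0 = 0%N :> nat ->
  sigma (delta_mx 0 i) = t_theta ^+ (n - i) *: delta_mx 0 i
    + sigma (embAt (AT F i.-1) *: delta_mx 0 i0).
Proof.
move=> i_gt0 Ei0; rewrite sigmaZ (sigma_delta0 Ei0) scalerA sigma_base.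
apply/rowP => j; rewrite !mxE i_gt0 !eqxx !mulr_natr /= eq_sym; congr (_ + _ *+ _).
by rewrite -val_eqE /= Ei0.
Qed.

Let spanned_delta (i : 'I_n) p : spanned (p *: delta_mx 0 i).
Proof.
have span0 (i0 : 'I_n) p' : i0 = 0%N :> nat -> spanned (p' *: delta_mx 0 i0).
  move=> Ei0; apply: (@spanned_step i0 0) => [|p'']; last by rewrite scaler0.
  by rewrite addr0 sigma_delta0 // Ei0 subn0.
have [i_gt0|] := ltnP 0 i; last by rewrite leqn0 => /eqP; apply: span0.
pose i0 := Ordinal (ltn_trans i_gt0 (ltn_ord i)).
apply: (@spanned_step i (- embAt (AT F i.-1) *: delta_mx 0 i0)) => [|p'].
  rewrite sigmaD (@sigma_deltaS _ i0) // -addrA -sigmaD -scalerDl subrr scale0r.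
  by rewrite sigma0 addr0.
by rewrite scalerA; apply: span0.
Qed.

Lemma sigma_comb_onto m : spanned m.
Proof. by rewrite [m]row_sum_delta; apply: spanned_sum. Qed.

Let sig1 e (g : {poly K}) := twist g * t_theta ^+ e.

Let sig1_sum e I (r : seq I) (P : pred I) (G : I -> {poly K}) :
  sig1 e (\sum_(i <- r | P i) G i) = \sum_(i <- r | P i) sig1 e (G i).
Proof.
by rewrite /sig1 (big_morph twist twistD twist0) mulr_suml.
Qed.

(* Freeness over K[sigma] in rank one: distinct powers of t - theta of        *)
(* exponents less than e are independent for sigma g = g^(-1) (t - theta)^e.  *)
Let free1 (I : finType) (P : pred I) (l : I -> nat) e N (c : I -> nat -> K) :
  {in P &, injective l} -> (forall i, P i -> (l i < e)%N) ->
  \sum_(i | P i) \sum_(j < N) iter j (sig1 e) ((c i j)%:P * t_theta ^+ l i) = 0 ->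
  forall i j, P i -> (j < N)%N -> c i j = 0.
Proof.
move=> l_inj lt_le; elim: N c => // N IHN c.
under eq_bigr do rewrite big_ord_recl /=.
rewrite big_split /= => E0.
set S0 := \sum_(i | P i) _ in E0; set S1 := \sum_(i | P i) _ in E0.
pose T := \sum_(i | P i) \sum_(j < N) iter j (sig1 e) ((c i j.+1)%:P * t_theta ^+ l i).
have ES1 : S1 = sig1 e T.
  by rewrite /T sig1_sum; apply: eq_bigr => i _; rewrite sig1_sum.
have szS0 : (size S0 <= e)%N.
  rewrite (leq_trans (size_sum _ _ _)) //; apply/bigmax_leqP => i Pi.
  rewrite mul_polyC (leq_trans (size_scale_leq _ _)) // size_t_theta_exp.
  exact: lt_le.
have T0 : T = 0.
  apply: twist_inj; rewrite twist0; apply/eqP.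
  have ES0 : S0 = - (twist T) * t_theta ^+ e.
    by apply/eqP; rewrite mulNr -addr_eq0 -/(sig1 e T) -ES1 E0.
  apply: contraTT szS0 => nz; rewrite ES0 size_Mmonic ?oppr_eq0 ?monic_exp //.
  by rewrite -ltnNge size_t_theta_exp addnS /= size_polyN -{1}[e]add0n ltn_add2r size_poly_gt0.
have S0_0 : S0 = 0 by move: E0; rewrite ES1 T0 /sig1 twist0 mul0r addr0.
move=> i [|j] Pi ltj; last by apply: (IHN (fun i j => c i j.+1)).
have t_comp m : (t_theta ^+ m) \Po ('X + (embA 'X)%:P) = 'X^m.
  elim: m => [|m IHm]; first by rewrite !expr0 comp_polyC.
  rewrite !exprS comp_polyM IHm /t_theta comp_polyB comp_polyX comp_polyC.
  by rewrite addrK.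
have := congr1 (fun p : {poly K} => p \Po ('X + (embA 'X)%:P)) S0_0.
rewrite comp_poly0 /S0 linear_sum /= => /polyP/(_ (l i)).
rewrite coef0 coef_sum (bigD1 i) //= big1 => [|i' /andP[Pi' nei']].
  by rewrite comp_polyM comp_polyC t_comp coefCM coefXn eqxx mulr1 addr0.
rewrite comp_polyM comp_polyC t_comp coefCM coefXn.
case: eqP => [/l_inj Eii'|]; last by rewrite mulr0.
by rewrite Eii' ?eqxx // in nei'.
Qed.

Let iter_sig1_0 e j : iter j (sig1 e) 0 = 0.
Proof. by elim: j => //= j ->; rewrite /sig1 twist0 mul0r. Qed.

Let iter_coord (i : 'I_n) j m : (0 < i)%N ->
  iter j sigma m 0 i = iter j (sig1 (n - i)) (m 0 i).
Proof.
move=> i_gt0; elim: j => //= j <-; rewrite sigma_coord (bigD1 i) //= mxE eqxx.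
rewrite [X in _ && X]eqn0Ngt i_gt0 andbF addr0 mulr1n /sig1.
rewrite big1 ?addr0 // => i' /negPf nei'; rewrite mxE nei'.
by rewrite [X in _ && X]eqn0Ngt i_gt0 andbF addr0 mulr0.
Qed.

Let iter_delta0 (i0 : 'I_n) j g : i0 = 0%N :> nat ->
  iter j sigma (g *: delta_mx 0 i0) = iter j (sig1 n) g *: delta_mx 0 i0.
Proof.
move=> Ei0; elim: j => //= j ->.
by rewrite sigmaZ sigma_delta0 // scalerA.
Qed.

Lemma sigma_comb_eq0 u : sigma_comb u = 0 -> forall k, u k = 0.
Proof.
move=> u0 k0; have : (0 < size nu_idx)%N by rewrite nu_idx_size (leq_ltn_trans _ (ltn_ord k0)).
case Efwd: nu_idx => [//|il0 fs] _.
pose idx (k : 'I_dimE) := nth il0 nu_idx k.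
have idx_inj : injective idx.
  by move=> k k' /eqP; rewrite nth_uniq ?nu_idx_size // => /eqP/val_inj.
have idx_lt k : ((idx k).2 < n - (idx k).1)%N.
  by rewrite -nu_idx_mem -surjective_pairing mem_nth // nu_idx_size.
have l_inj (i : 'I_n) :
    {in (fun k => (idx k).1 == i) &, injective (fun k => (idx k).2)}.
  move=> k k' /eqP Ek /eqP Ek' Ekk'; apply: idx_inj.
  by rewrite [LHS]surjective_pairing [RHS]surjective_pairing Ek Ek' Ekk'.
pose N := (\max_k size (u k)).+1.
have leN k : (size (u k) <= N)%N by apply: leqW; apply: leq_bigmax.
have coef_0 k : (forall j, (j < N)%N -> (u k)`_j = 0) -> u k = 0.
  move=> uk0; apply/polyP => j; rewrite coef0; have [/uk0//|leNj] := ltnP j N.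
  by rewrite nth_default // (leq_trans (leN k)).
have {}u0 : \sum_k \sum_(j < N)
    iter j sigma (((u k)`_j)%:P *: (t_theta ^+ (idx k).2 *: delta_mx 0 (idx k).1)) = 0.
  rewrite -[RHS]u0 combE; apply: eq_bigr => k _; rewrite (term_widen _ (leN k)).
  by apply: eq_bigr => j _; rewrite (nus_nth k il0).
have pos0 k : (0 < (idx k).1)%N -> u k = 0.
  set i := (idx k).1 => i_gt0; apply: coef_0 => j ltj.
  apply: (@free1 _ (fun k => (idx k).1 == i) (fun k => (idx k).2) (n - i) N
            (fun k j => (u k)`_j)) => //.
  - by move=> k' /eqP <-; apply: idx_lt.
  - move/rowP/(_ i): u0; rewrite summxE mxE (bigID (fun k => (idx k).1 == i)) /=.
    rewrite [X in _ + X]big1 => [|k' /negPf nek'].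
      rewrite addr0 => u0; rewrite -[RHS]u0; apply: eq_bigr => k' /eqP Ek'.
      rewrite summxE; apply: eq_bigr => j' _; rewrite iter_coord // !mxE Ek' !eqxx.
      by rewrite mulr1.
    rewrite summxE big1 // => j' _; rewrite iter_coord // !mxE eq_sym nek' andbF.
    by rewrite !mulr0 iter_sig1_0.
have [/pos0//|] := ltnP 0 (idx k0).1; rewrite leqn0 => /eqP Ei0.
set i0 := (idx k0).1 in Ei0; apply: coef_0 => j ltj.
apply: (@free1 _ (fun k => (idx k).1 == i0) (fun k => (idx k).2) n N
          (fun k j => (u k)`_j)) => //.
- by move=> k' /eqP Ek'; have := idx_lt k'; rewrite Ek' Ei0 subn0.
- move: u0; rewrite (bigID (fun k => (idx k).1 == i0)) /=.
  rewrite [X in _ + X]big1 => [|k' nek'].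
    move=> /rowP/(_ i0); rewrite addr0 summxE mxE => u0; rewrite -[RHS]u0.
    apply: eq_bigr => k' /eqP Ek'; rewrite summxE; apply: eq_bigr => j' _.
    by rewrite Ek' scalerA iter_delta0 // !mxE !eqxx mulr1.
  have uk'0 : u k' = 0.
    apply: pos0; rewrite lt0n; apply: contra nek' => /eqP Ek'; apply/eqP/val_inj.
    by rewrite /= Ek'.
  by rewrite big1 // => j' _; rewrite uk'0 coef0 scale0r iter_sigma0.
Qed.

Lemma sigma_comb_inj u u' : sigma_comb u = sigma_comb u' -> u =1 u'.
Proof.
move=> Eu i; apply/eqP; rewrite -subr_eq0; apply/eqP.
apply: (@sigma_comb_eq0 (fun i => u i - u' i)).
apply: (addIr (sigma_comb u')); rewrite add0r -sigma_combD -Eu.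
by apply: sigma_comb_ext => i'; rewrite subrK.
Qed.

(* M' is free over K[sigma] with basis nus, so Delta is well defined.         *)
Lemma Delta_exists : {D : 'rV[{poly K}]_n -> 'cV[K]_dimE |
  forall u, D (sigma_comb u) = \col_i delta (u i)}.
Proof.
exists (fun m => \col_i delta (xchoose (sigma_comb_onto m) i)) => u.
apply/colP => i; rewrite !mxE; congr delta; apply: sigma_comb_inj.
exact/eqP/(xchooseP (sigma_comb_onto (sigma_comb u))).
Qed.

Definition Delta : 'rV[{poly K}]_n -> 'cV[K]_dimE := sval Delta_exists.

Lemma DeltaE u : Delta (sigma_comb u) = \col_i delta (u i).
Proof. exact: (svalP Delta_exists). Qed.

Let deltaE p : delta p = p.[1].
Proof.
by rewrite horner_coef; apply: eq_bigr => j _; rewrite expr1n mulr1.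
Qed.

Let DeltaD m m' : Delta (m + m') = Delta m + Delta m'.
Proof.
have [[u /eqP<-] [u' /eqP<-]] := (sigma_comb_onto m, sigma_comb_onto m').
by rewrite -sigma_combD !DeltaE; apply/colP => i; rewrite !mxE !deltaE hornerD.
Qed.

Let Delta0 : Delta 0 = 0.
Proof. by apply: (addIr (Delta 0)); rewrite -DeltaD !add0r. Qed.

Let Delta_sigma j m : Delta (iter j sigma m) = Delta m.
Proof.
elim: j => //= j <-; have [u /eqP<-] := sigma_comb_onto (iter j sigma m).
rewrite sigma_comb_sigma !DeltaE; apply/colP => i.
by rewrite !mxE !deltaE hornerM hornerX mulr1.
Qed.

Let Delta_sum I (r : seq I) (P : pred I) (G : I -> 'rV_n) :
  Delta (\sum_(i <- r | P i) G i) = \sum_(i <- r | P i) Delta (G i).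
Proof. exact: (big_morph Delta DeltaD Delta0). Qed.

Lemma tau_actD alpha v w : tau_act alpha (v + w) = tau_act alpha v + tau_act alpha w.
Proof.
rewrite -big_split; apply: eq_bigr => i _ /=; rewrite -mulmxDr.
by congr (_ *m _); apply/matrixP => a b; rewrite !mxE frobDK.
Qed.

Lemma tau_act0 alpha : tau_act alpha 0 = 0.
Proof. by apply: (addIr (tau_act alpha 0)); rewrite -tau_actD !add0r. Qed.

Lemma rho_exists : {alpha : seq 'M[K]_dimE |
  forall m, Delta ('X *: m) = tau_act alpha (Delta m)}.
Proof.
have U_ex (l : 'I_dimE) := sigma_comb_onto ('X *: nus`_l).
pose U l : {ffun 'I_dimE -> {poly K}} := xchoose (U_ex l).
have UE l : sigma_comb (U l) = 'X *: nus`_l by exact/eqP/(xchooseP (U_ex l)).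
pose N := \max_l \max_i size (U l i).
have leN l i : (size (U l i) <= N)%N.
  by apply: leq_trans (leq_bigmax l); apply: (leq_bigmax i).
pose alpha := mkseq (fun j => \matrix_(i, l) (U l i)`_j : 'M[K]_dimE) N.
have alpha_nu (l : 'I_dimE) c : Delta ('X *: (c%:P *: nus`_l)) = tau_act alpha (c *: delta_mx l 0).
  rewrite scalerA mulrC -scalerA -UE combE scaler_sumr.
  rewrite (eq_bigr _ (fun i _ => term_scale _ _ _)) -combE DeltaE.
  apply/colP => i; rewrite mxE deltaE horner_poly summxE size_mkseq.
  transitivity (\sum_(j < N) c ^+ (q ^ j) * (U l i)`_j).
    rewrite -(big_mkord xpredT (fun j => c ^+ (q ^ j) * (U l i)`_j * 1 ^+ j)).
    rewrite -(big_mkord xpredT (fun j => c ^+ (q ^ j) * (U l i)`_j)).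
    rewrite [RHS](big_cat_nat (n := size (U l i))) //= [X in _ = _ + X]big_nat_cond.
    rewrite [X in _ = _ + X]big1 ?addr0 => [|j /andP[/andP[lej _] _]].
      by apply: eq_bigr => j _; rewrite expr1n mulr1.
    by rewrite nth_default // mulr0.
  apply: eq_bigr => j _; rewrite nth_mkseq // mxE (bigD1 l) //= !mxE eqxx mulr1.
  rewrite big1 ?addr0 1?mulrC // => l' /negPf nel'.
  by rewrite !mxE nel' mulr0 (frob0 F K) mulr0.
exists alpha => m; have [u /eqP<-] := sigma_comb_onto m.
rewrite DeltaE combE scaler_sumr Delta_sum.
transitivity (\sum_l tau_act alpha (delta (u l) *: delta_mx l 0)).
  apply: eq_bigr => l _; rewrite scaler_sumr Delta_sum /delta scaler_suml.
  rewrite (big_morph (tau_act alpha) (tau_actD alpha) (tau_act0 alpha)).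
  by apply: eq_bigr => j _; rewrite iter_sigmaX Delta_sigma alpha_nu.
rewrite -(big_morph (tau_act alpha) (tau_actD alpha) (tau_act0 alpha)).
congr tau_act; rewrite [RHS]matrix_sum_delta; apply: eq_bigr => l _.
by rewrite big_ord1 mxE.
Qed.

(* rho_t; it is unique up to trailing zero matrices since Delta is onto and K *)
(* is infinite.                                                               *)
Definition rho_t : seq 'M[K]_dimE := sval rho_exists.

Lemma rho_tE m : Delta ('X *: m) = tau_act rho_t (Delta m).
Proof. exact: (svalP rho_exists). Qed.

End Module.

(* f_C is the row (f_0, ..., f_(n-1)), i.e. the vector \sum_i f_i x_i of M'.  *)
Section IntegralPoint.
Variables (r s : nat) (C : (r + s).-tuple {fraction {poly F}}).
Local Notation n := (r + s)%N.
Local Notation H m := (twist (embAt (AT F m))).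

Definition f_C : 'rV[{poly K}]_n :=
  \row_(j < n)
    if j == 0%N :> nat then
      embAt (beta0 C) * H n.-1 * t_theta ^+ n
      - embAt (gamma0 C) * H r.-1 * H s.-1 * t_theta ^+ n
    else embAt (alpha C j) * H (n - j).-1 * t_theta ^+ (n - j).

Definition v_C : 'cV[K]_(dimE n) := Delta f_C.

End IntegralPoint.

End AlgebraicClosure.

(* Main.v *)
Require Import Defs.
From HB Require Import structures.
From mathcomp Require Import all_boot all_order all_algebra all_field.

Set Implicit Arguments.
Unset Strict Implicit.
Unset Printing Implicit Defensive.

Import GRing.Theory.
Local Open Scope ring_scope.

(** Call m in M' integral when c |-> Delta (c m) is given by q-polynomials
    with coefficients in A.  Integral elements are stable under addition,
    under sigma (Delta (c sigma m) = Delta (sigma (c^q m)) = Delta (c^q m)) and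
    under A, and they contain the basis nu.  Since
      (t - theta)^(n-i) x_i = sigma (x_i - H_(i-1) x_0)   (no H term if i = 0),
    division by (t - theta)^(n-i) shows by induction on the degree in t that
    f x_i is integral for every f in A[t].  Applied to t nu_l this makes rho_t
    integral, because a q-polynomial over the infinite field K is
    determined by its values.  Finally alpha_j, beta_0 and gamma_0 have
    coefficients in F_q, hence are fixed by the twist, so that (f_0, ...) is
    sigma of a vector over A[t]. *)

(** * q-polynomials and their values over [K] *)

Section QPolynomials.
Variables (F : finFieldType) (K : closedFieldType).
Local Notation q := #|F|.
Implicit Types p : {poly K}.

Definition qpoly (p : {poly K}) : {poly K} := \sum_(j < size p) p`_j *: 'X^(q ^ j).

Lemma qpoly_widen N p : (size p <= N)%N ->
  qpoly p = \sum_(j < N) p`_j *: 'X^(q ^ j).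
Proof.
move=> lepN; rewrite /qpoly.
rewrite (big_ord_widen N (fun j => p`_j *: 'X^(q ^ j)) lepN) big_mkcond /=.
apply: eq_bigr => j _; case: ltnP => // lepj.
by rewrite nth_default // scale0r.
Qed.

Lemma qpolyD p p' : qpoly (p + p') = qpoly p + qpoly p'.
Proof.
pose N := maxn (size p) (size p').
rewrite !(@qpoly_widen N) ?leq_maxl ?leq_maxr ?(leq_trans (size_polyD _ _)) //.
by rewrite -big_split; apply: eq_bigr => j _; rewrite coefD scalerDl.
Qed.

Lemma qpoly0 : qpoly 0 = 0.
Proof. by rewrite /qpoly size_poly0 big_ord0. Qed.

Lemma horner_qpolyMX p c : (qpoly (p * 'X)).[c] = (qpoly p).[c ^+ q].
Proof.
rewrite (@qpoly_widen (size p).+1); last first.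
  by rewrite (leq_trans (size_polyMleq _ _)) // size_polyX addnC.
rewrite big_ord_recl coefMX scale0r add0r !horner_sum.
apply: eq_bigr => j _; rewrite !hornerZ !hornerXn coefMX /=.
by rewrite -exprM -expnS.
Qed.

Lemma qpolyC a : qpoly a%:P = a *: 'X.
Proof.
by rewrite (@qpoly_widen 1) ?size_polyC_leq1 // big_ord1 coefC.
Qed.

Lemma horner_qpoly_scale p a c :
  (qpoly (\poly_(j < size p) (p`_j * a ^+ (q ^ j)))).[c] = (qpoly p).[a * c].
Proof.
rewrite (@qpoly_widen (size p)) ?size_poly // !horner_sum.
apply: eq_bigr => j _; rewrite !hornerZ !hornerXn coef_poly ltn_ord.
by rewrite exprMn mulrA.
Qed.

(** Since q > 1 the exponents q^j are distinct, so no two terms collide. *)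
Lemma coef_qpoly p j : (qpoly p)`_(q ^ j) = p`_j.
Proof.
rewrite (@qpoly_widen (maxn (size p) j.+1)) ?leq_maxl // coef_sum.
have ltj : (j < maxn (size p) j.+1)%N by rewrite leq_maxr.
rewrite (bigD1 (Ordinal ltj)) //= big1 => [|i neij].
  by rewrite coefZ coefXn eqxx mulr1 addr0.
rewrite coefZ coefXn; case: eqP => [/(expnI (finNzRing_gt1 F)) Eji|]; last first.
  by rewrite mulr0.
by case/eqP: neij; apply: val_inj.
Qed.

(** Unless p - 1 is a nonzero constant it has a root, and there p takes the value 1. *)
Lemma closed_poly_eq0 (p : {poly K}) : (forall c, p.[c] = 0) -> p = 0.
Proof.
move=> p0; have [/size_poly1P[a _ Ep]|szp] := boolP (size (p - 1) == 1%N).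
  have Ep1 : p = (a + 1)%:P by rewrite polyCD -Ep subrK.
  by move: (p0 0); rewrite Ep1 hornerC => ->.
have /closed_rootP[c] := szp; rewrite rootE hornerD hornerN p0 hornerC sub0r.
by rewrite oppr_eq0 oner_eq0.
Qed.

Lemma qpoly_inj p p' : (forall c, (qpoly p).[c] = (qpoly p').[c]) -> p = p'.
Proof.
move=> Epp'; have Eq : qpoly p = qpoly p'.
  apply/eqP; rewrite -subr_eq0; apply/eqP/closed_poly_eq0 => c.
  by rewrite hornerD hornerN Epp' subrr.
by apply/polyP => j; rewrite -(coef_qpoly p) -(coef_qpoly p') Eq.
Qed.

End QPolynomials.

(** * The twist on polynomials coming from A[t] *)

Section Integrality.
Variables (F : finFieldType) (K : closedFieldType).
Variable emb : {rmorphism {fraction {poly F}} -> K}.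
Local Notation A := {poly F}.
Local Notation q := #|F|.
Local Notation embA := (embA emb).
Local Notation embAt := (embAt emb).
Local Notation twist := (@twist F K).
Local Notation t_theta := (t_theta emb).

HB.instance Definition _ :=
  GRing.RMorphism.copy embA (emb \o (@FracField.tofrac _)).
HB.instance Definition _ := GRing.RMorphism.copy embAt (map_poly embA).

Lemma coef_embAt f j : (embAt f)`_j = embA f`_j.
Proof. exact: coef_map. Qed.

(** Inverse of the twist. Unlike the twist it preserves A[t], so a factor in A[t] can be moved
    inside [sigma] and stay in A[t]. *)
Definition frobAt (f : {poly A}) : {poly A} := map_poly (fun a => a ^+ q) f.

Lemma twist_frobAt f : twist (embAt (frobAt f)) = embAt f.
Proof.
apply/polyP => j; rewrite (coef_twist emb) !coef_embAt coef_map_id0; last first.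
  by rewrite expr0n; case: q (finNzRing_gt1 F).
by rewrite /= rmorphXn (expqK emb).
Qed.

Lemma twistN f : twist (- f) = - twist f.
Proof. by apply: (addrI (twist f)); rewrite -(twistD emb) !subrr (twist0 emb). Qed.

Lemma twist_const (a : A) : twist (embAt a^:P) = embAt a^:P.
Proof.
rewrite -[RHS]twist_frobAt; congr (twist (embAt _)).
apply/polyP => j; rewrite [RHS]coef_map_id0; last first.
  by rewrite expr0n; case: q (finNzRing_gt1 F).
by rewrite !coef_map /= -polyC_exp expf_card.
Qed.

Lemma embAtX : embAt 'X = 'X. Proof. exact: map_polyX. Qed.

Lemma embAtC a : embAt a%:P = (embA a)%:P. Proof. exact: map_polyC. Qed.

Lemma embAt_t_theta : embAt ('X - ('X)%:P) = t_theta.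
Proof. by rewrite rmorphB /= embAtX embAtC. Qed.

(** * Integral elements of M' *)

Section Module.
Variable n : nat.
Local Notation sigma := (@sigma F K emb n).
Local Notation Delta := (@Delta F K emb n).
Local Notation nus := (nus emb n).
Local Notation x_ i := (delta_mx 0 i : 'rV[{poly K}]_n).

(** In this form [delta] is visibly additive and blind to a factor ['X], that is, to sigma. *)
Lemma deltaE (p : {poly K}) : delta p = p.[1].
Proof.
by rewrite horner_coef; apply: eq_bigr => j _; rewrite expr1n mulr1.
Qed.

Lemma DeltaD m m' : Delta (m + m') = Delta m + Delta m'.
Proof.
have [u /eqP<-] := sigma_comb_onto emb m.
have [u' /eqP<-] := sigma_comb_onto emb m'.
rewrite -sigma_combD !DeltaE; apply/colP => i.
by rewrite !mxE !deltaE hornerD.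
Qed.

Lemma Delta0 : Delta 0 = 0.
Proof. by apply: (addIr (Delta 0)); rewrite -DeltaD !add0r. Qed.

Lemma Delta_sigma m : Delta (sigma m) = Delta m.
Proof.
have [u /eqP<-] := sigma_comb_onto emb m.
rewrite sigma_comb_sigma !DeltaE; apply/colP => i.
by rewrite !mxE !deltaE hornerM hornerX mulr1.
Qed.

Lemma Delta_nu (l : 'I_(dimE n)) c : Delta (c%:P *: nus`_l) = c *: delta_mx l 0.
Proof.
have -> : c%:P *: nus`_l = sigma_comb emb (fun i => if i == l then c%:P else 0).
  rewrite /sigma_comb (bigD1 l) //= eqxx [X in _ + X]big1 => [|i /negPf->].
    rewrite addr0 size_polyC; case: eqVneq => [->|_].
      by rewrite big_ord0 scale0r.
    by rewrite big_ord1 coefC.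
  by rewrite size_poly0 big_ord0.
rewrite DeltaE; apply/colP => i; rewrite !mxE deltaE andbT.
by case: eqP => _; rewrite ?mulr1 ?mulr0 hornerC.
Qed.

(** Integrality of [Delta m] alone would not control the multiples of m; the dependence on c also
    carries the coefficients of [rho_t]. *)
Definition qintegral (m : 'rV[{poly K}]_n) : Prop :=
  exists w : 'I_(dimE n) -> {poly A},
    forall c, Delta (c%:P *: m) = \col_i (qpoly F (embAt (w i))).[c].

Lemma qintegral0 : qintegral 0.
Proof.
exists (fun=> 0) => c; rewrite scaler0 Delta0; apply/colP => i.
by rewrite !mxE rmorph0 qpoly0 hornerC.
Qed.

Lemma qintegralD m m' : qintegral m -> qintegral m' -> qintegral (m + m').
Proof.
move=> [w Ew] [w' Ew']; exists (fun i => w i + w' i) => c.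
rewrite scalerDr DeltaD Ew Ew'; apply/colP => i.
by rewrite !mxE rmorphD qpolyD hornerD.
Qed.

Lemma qintegral_sum I (r : seq I) (P : pred I) (G : I -> 'rV_n) :
  (forall i, P i -> qintegral (G i)) -> qintegral (\sum_(i <- r | P i) G i).
Proof.
by move=> PG; elim/big_ind: _ => //; [apply: qintegral0 | apply: qintegralD].
Qed.

Lemma qintegral_sigma m : qintegral m -> qintegral (sigma m).
Proof.
move=> [w Ew]; exists (fun i => w i * 'X) => c.
rewrite -[c](expqK emb) -(twistC emb) -sigmaZ Delta_sigma Ew; apply/colP => i.
by rewrite !mxE rmorphM /= embAtX horner_qpolyMX (expqK emb).
Qed.

Lemma qintegralZ (a : A) m : qintegral m -> qintegral ((embA a)%:P *: m).
Proof.
move=> [w Ew].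
(* Replacing c by a c multiplies the coefficient of tau^j by a^(q^j), which stays in A. *)
exists (fun i => \poly_(j < size (w i)) ((w i)`_j * a ^+ (q ^ j))) => c.
rewrite scalerA -polyCM Ew; apply/colP => i; rewrite !mxE.
rewrite [c * _]mulrC -horner_qpoly_scale; congr ((qpoly F _).[c]).
(* Injectivity gives [w i] and its image the same size, so both truncations agree. *)
have embA_inj : injective embA.
  by apply: inj_comp (fmorph_inj _) _ => x y /eqP; rewrite tofrac_eq => /eqP.
apply/polyP => j; rewrite [RHS]coef_embAt !coef_poly.
rewrite (size_map_inj_poly embA_inj) ?rmorph0 //.
by case: ltnP => _; rewrite ?rmorph0 // rmorphM rmorphXn.
Qed.

Lemma qintegral_nu (l : 'I_(dimE n)) : qintegral nus`_l.
Proof.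
exists (fun i => ((i == l)%:R)%:P) => c; rewrite Delta_nu; apply/colP => i.
rewrite !mxE andbT embAtC rmorph_nat qpolyC hornerZ hornerX.
by rewrite mulrC.
Qed.

(** The expansion of f in powers of t - theta has coefficients in A and exponents below n - i,
    exactly those occurring with x_i in [nus]. *)
Lemma qintegral_low (i : 'I_n) (f : {poly A}) : (size f <= n - i)%N ->
  qintegral (embAt f *: x_ i).
Proof.
move=> lef; have -> : f = (f \Po ('X + ('X)%:P)) \Po ('X - ('X)%:P).
  by rewrite -comp_polyA comp_polyD comp_polyX comp_polyC subrK comp_polyXr.
rewrite comp_polyE rmorph_sum scaler_suml; apply: qintegral_sum => l _.
rewrite -mul_polyC rmorphM rmorphXn /= embAt_t_theta embAtC -scalerA.
apply: qintegralZ.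
have ltl : (l < n - i)%N.
  by rewrite (leq_trans (ltn_ord l)) // size_comp_poly2 // size_XaddC.
have nu_l : t_theta ^+ l *: x_ i \in nus.
  apply/allpairsPdep; exists i, (nat_of_ord l); split=> //.
    by rewrite mem_enum.
  by rewrite mem_rev mem_iota.
have lt_nu : (index (t_theta ^+ l *: x_ i) nus < dimE n)%N.
  by rewrite -(size_nus emb) index_mem.
by have := qintegral_nu (Ordinal lt_nu); rewrite nth_index.
Qed.

(** For i > 0 the subtracted term cancels the off-diagonal entry of row i; taking 0 for i = 0 gives
    both cases one shape. *)
Lemma sigma_delta (i i0 : 'I_n) : i0 = 0%N :> nat ->
  t_theta ^+ (n - i) *: x_ i =
  sigma (x_ i - embAt (if (0 < i)%N then AT F i.-1 else 0) *: x_ i0).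
Proof.
move=> Ei0.
have sigma_x j : sigma (x_ j) = row j (sigma_matrix emb n).
  rewrite /Defs.sigma rowE; congr (_ *m _); apply/matrixP => a b; rewrite !mxE.
  case: (_ && _); rewrite ?mulr1n ?mulr0n ?(twist0 emb) //.
  by rewrite -polyC1 (twistC emb) (qroot1 emb).
rewrite -scaleNr sigmaD sigmaZ !sigma_x twistN; apply/rowP => j; rewrite !mxE.
rewrite Ei0 ltnn subn0 addr0 -!val_eqE /= Ei0 (eq_sym 0%N) (eq_sym (i : nat)).
rewrite mulr_natr; case: ifP => i_gt0 /=; last first.
  by rewrite rmorph0 (twist0 emb) oppr0 mul0r !addr0.
by rewrite mulNr mulrnAr addrK.
Qed.

Lemma qintegral_step (i i0 : 'I_n) (h : {poly A}) :
    t_theta ^+ (n - i) *: x_ i = sigma (x_ i - embAt h *: x_ i0) ->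
    (forall g, qintegral (embAt (g * h) *: x_ i0)) ->
  forall f, qintegral (embAt f *: x_ i).
Proof.
move=> Eh Hh f; elim: {f}(size f) {-2}f (leqnn (size f)) => [|N IHN] f lef.
  by apply: qintegral_low; apply: leq_trans lef _.
pose D : {poly A} := ('X - ('X)%:P) ^+ (n - i).
have D_mon : D \is monic by rewrite monic_exp ?monicXsubC.
have szD : size D = (n - i).+1 by apply: size_exp_XsubC.
rewrite (Pdiv.IdomainMonic.divp_eq D_mon f) rmorphD scalerDl.
apply: qintegralD; last first.
  by apply: qintegral_low; rewrite -ltnS -szD ltn_modp monic_neq0.
(* The quotient enters [sigma] as its [frobAt], whose size is no larger. Division by [D] lowers the
   degree by n - i > 0, so the induction applies. *)
rewrite rmorphM rmorphXn /= embAt_t_theta -scalerA Eh -twist_frobAt -sigmaZ.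
apply: qintegral_sigma; rewrite scalerBr -scaleNr scalerA -rmorphN -rmorphM.
apply: qintegralD; last exact: Hh.
apply: IHN; rewrite (leq_trans (size_poly _ _)) //.
rewrite size_divp ?monic_neq0 // szD leq_subLR (leq_trans lef) //.
by rewrite -add1n leq_add2r subn_gt0.
Qed.

Lemma qintegral_At (i : 'I_n) (f : {poly A}) : qintegral (embAt f *: x_ i).
Proof.
pose i0 := Ordinal (leq_ltn_trans (leq0n i) (ltn_ord i)).
(* Index 0 comes first: there h = 0 and the induction closes by itself. The other indices use it for
   their x_0 term. *)
have Hi0 g : qintegral (embAt g *: x_ i0).
  apply: (@qintegral_step i0 i0 0) => [|g'].
    exact: (sigma_delta i0 (erefl : i0 = 0%N :> nat)).
  by rewrite mulr0 rmorph0 scale0r; apply: qintegral0.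
by apply: (qintegral_step (sigma_delta i (erefl : i0 = 0%N :> nat))) => g.
Qed.

(** * Integrality of [rho_t] *)

Lemma qintegral_tnu (l : 'I_(dimE n)) : qintegral ('X *: nus`_l).
Proof.
have : nus`_l \in nus by rewrite mem_nth // size_nus.
move=> /allpairsPdep[i [e [_ _ ->]]].
by rewrite scalerA -embAtX -embAt_t_theta -rmorphXn -rmorphM; apply: qintegral_At.
Qed.

(* Column l of rho_t is the q-polynomial c |-> Delta (c t nu_l). *)
Lemma rho_t_integral j : integral_mx emb (rho_t emb n)`_j.
Proof.
have [w Ew] := fin_all_exists qintegral_tnu.
exists (\matrix_(i, l) (w l i)`_j); apply/matrixP => i l; rewrite !mxE.
pose p := \poly_(j < size (rho_t emb n)) (rho_t emb n)`_j i l.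
(* Beyond the end of the list the default is the zero matrix, so every j is covered. *)
have -> : (rho_t emb n)`_j i l = p`_j.
  by rewrite coef_poly; case: ltnP => // lej; rewrite nth_default // mxE.
rewrite -coef_embAt; suff -> : p = embAt (w l i) by [].
apply: (@qpoly_inj F) => c.
transitivity (Delta (c%:P *: ('X *: nus`_l)) i 0); last by rewrite Ew mxE.
rewrite scalerA mulrC -scalerA rho_tE Delta_nu.
rewrite (@qpoly_widen _ _ (size (rho_t emb n))) ?size_poly //.
rewrite horner_sum summxE; apply: eq_bigr => j' _.
rewrite hornerZ hornerXn coef_poly ltn_ord mxE (bigD1 l) //= !mxE !eqxx mulr1.
(* The vector c e_l has zeros off l, and 0^(q^j) = 0, so only column l contributes. *)
rewrite big1 ?addr0 // => l' /negPf nel'.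
rewrite !mxE nel' mulr0 expr0n expn_eq0 -[q == 0%N]negbK -lt0n.
by rewrite (ltnW (finNzRing_gt1 F)) mulr0.
Qed.

(** * Integrality of [v_C] *)

Lemma qintegral_Delta m : qintegral m -> integral_mx emb (Delta m).
Proof.
move=> [w Ew]; exists (\col_i \sum_(j < size (embAt (w i))) (w i)`_j).
(* At c = 1 a q-polynomial takes the sum of its coefficients. *)
rewrite -[m]scale1r Ew; apply/colP => i; rewrite !mxE rmorph_sum horner_sum.
by apply: eq_bigr => j _; rewrite hornerZ hornerXn expr1n mulr1 coef_embAt.
Qed.

(** The twist of f may leave A[t], but this vector is [sigma] of one over A[t]. Each entry of [f_C]
    has this shape. *)
Lemma qintegral_twist (i : 'I_n) (f : {poly A}) :
  qintegral ((twist (embAt f) * t_theta ^+ (n - i)) *: x_ i).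
Proof.
pose i0 := Ordinal (leq_ltn_trans (leq0n i) (ltn_ord i)).
rewrite -scalerA (sigma_delta i (erefl : i0 = 0%N :> nat)) -sigmaZ.
apply: qintegral_sigma; rewrite -scaleNr scalerDr scalerA -rmorphN -rmorphM.
by apply: qintegralD; apply: qintegral_At.
Qed.

End Module.

Lemma v_C_integral (r s : nat) (C : (r + s).-tuple {fraction A}) :
  integral_mx emb (v_C emb C).
Proof.
apply: qintegral_Delta; rewrite [f_C _ _]row_sum_delta.
apply: qintegral_sum => i _; rewrite mxE; case: eqP => [i0|_]; last first.
  by rewrite /alpha -twist_const -(twistM emb) -rmorphM; apply: qintegral_twist.
rewrite -mulrBl /beta0 /gamma0 -(twist_const (polypart (b_term _ * _))).
rewrite -(twist_const (polypart (c_term _ _ _ * _))) -!(twistM emb) -!rmorphM.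
rewrite -twistN -(twistD emb) -rmorphB.
(* The exponent n is rewritten as n - i, with i = 0. *)
rewrite -[X in t_theta ^+ X]subn0 -[X in (_ - X)%N]i0.
exact: qintegral_twist.
Qed.

End Integrality.

Theorem theoremA1 (F : finFieldType) (K : closedFieldType)
    (emb : {rmorphism {fraction {poly F}} -> K})
    (emb_alg : forall z : K, algebraicOver emb z)
    (r s : nat) (r_gt0 : (0 < r)%N) (s_gt0 : (0 < s)%N)
    (C : (r + s).-tuple {fraction {poly F}}) :
  (forall i : nat, integral_mx emb (rho_t emb (r + s))`_i)
  /\ integral_mx emb (v_C emb C).
Proof. by split; [apply: rho_t_integral | apply: v_C_integral]. Qed.
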